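(* Let $(D,\prec,\succ,\{~,~,~\}_{[1]},\{~,~,~\}_{[2]},\{~,~,~\}_{[3]},\{\!\{~,~,~\}\!\}_{[1]},\{\!\{~,~,~\}\!\}_{[2]},\{\!\{~,~,~\}\!\}_{[3]})$ be a dendriform-Yamaguti algebra with total associative-Yamaguti algebra $D_{\mathrm{Tot}}=(D,\cdot_{\mathrm{Tot}},\{~,~,~\}_{\mathrm{Tot}},\{\!\{~,~,~\}\!\}_{\mathrm{Tot}})$. Define maps $\cdot:D_{\mathrm{Tot}}\otimes D\to D$ by $a\cdot b:=a\succ b$, and $\cdot:D\otimes D_{\mathrm{Tot}}\to D$ by $a\cdot b:=a\prec b$; $\{~,~,~\}:D_{\mathrm{Tot}}\otimes D_{\mathrm{Tot}}\otimes D\to D$ by $\{a,b,c\}:=\{a,b,c\}_{[3]}$; $\{~,~,~\}:D_{\mathrm{Tot}}\otimes D\otimes D_{\mathrm{Tot}}\to D$ by $\{a,b,c\}:=\{a,b,c\}_{[2]}$; $\{~,~,~\}:D\otimes D_{\mathrm{Tot}}\otimes D_{\mathrm{Tot}}\to D$ by $\{a,b,c\}:=\{a,b,c\}_{[1]}$; $\{\!\{~,~,~\}\!\}:D_{\mathrm{Tot}}\otimes D_{\mathrm{Tot}}\otimes D\to D$ by $\{\!\{a,b,c\}\!\}:=\{\!\{a,b,c\}\!\}_{[3]}$; $\{\!\{~,~,~\}\!\}:D_{\mathrm{Tot}}\otimes D\otimes D_{\mathrm{Tot}}\to D$ by $\{\!\{a,b,c\}\!\}:=\{\!\{a,b,c\}\!\}_{[2]}$;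 $\{\!\{~,~,~\}\!\}:D\otimes D_{\mathrm{Tot}}\otimes D_{\mathrm{Tot}}\to D$ by $\{\!\{a,b,c\}\!\}:=\{\!\{a,b,c\}\!\}_{[1]}$. (i) With these eight maps $\cdot$ (two maps, given by $\succ$ and $\prec$), $\{~,~,~\}$ (three maps, given by $\{~,~,~\}_{[3]},\{~,~,~\}_{[2]},\{~,~,~\}_{[1]}$) and $\{\!\{~,~,~\}\!\}$ (three maps, given by $\{\!\{~,~,~\}\!\}_{[3]},\{\!\{~,~,~\}\!\}_{[2]},\{\!\{~,~,~\}\!\}_{[1]}$) as action maps, $D$ is a representation of the associative-Yamaguti algebra $D_{\mathrm{Tot}}$. (ii) The identity map $\mathrm{Id}:D\to D_{\mathrm{Tot}}$ is a relative Rota-Baxter operator. Moreover, the dendriform-Yamaguti algebra structure on $D$ induced by this relative Rota-Baxter operator coincides with the given one.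
   Context: All vector spaces, linear maps and tensor products are over a field $\mathbf{k}$ of characteristic $0$. An associative-Yamaguti algebra is a quadruple $(A,\cdot,\{~,~,~\},\{\!\{~,~,~\}\!\})$ consisting of a vector space $A$ with linear operations $\cdot:A\otimes A\to A$ and $\{~,~,~\},\{\!\{~,~,~\}\!\}:A\otimes A\otimes A\to A$ such that for all $a,b,c,d,e\in A$: (AY1) $(a\cdot b)\cdot c-a\cdot(b\cdot c)+\{a,b,c\}-\{\!\{a,b,c\}\!\}=0$; (AY2) $\{a\cdot b,c,d\}=\{a,b\cdot c,d\}$; (AY3) $\{a,b,c\cdot d\}=\{a,b,c\}\cdot d$; (AY4) $\{\!\{a\cdot b,c,d\}\!\}=a\cdot\{\!\{b,c,d\}\!\}$; (AY5) $\{\!\{a,b\cdot c,d\}\!\}=\{\!\{a,b,c\cdot d\}\!\}$; (AY6) $a\cdot\{b,c,d\}=\{\!\{a,b,c\}\!\}\cdot d$; (AY7) $\{\{a,b,c\},d,e\}=\{a,\{\!\{b,c,d\}\!\},e\}=\{a,b,\{c,d,e\}\}$; (AY8) $\{a,\{b,c,d\},e\}=\{\{\!\{a,b,c\}\!\},d,e\}$; (AY9) $\{\!\{\{\!\{a,b,c\}\!\},d,e\}\!\}=\{\!\{a,\{b,c,d\},e\}\!\}=\{\!\{a,b,\{\!\{c,d,e\}\!\}\}\!\}$; (AY10) $\{\!\{a,\{\!\{b,c,d\}\!\},e\}\!\}=\{\!\{a,b,\{c,d,e\}\}\!\}$; (AY11) $\{a,b,\{\!\{c,d,e\}\!\}\}=\{\!\{\{a,b,c\},d,e\}\!\}$.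 A representation of $A$ is a vector space $M$ with linear maps (denoted by the same symbols) $\cdot:A\otimes M\to M$, $\cdot:M\otimes A\to M$, and $\{~,~,~\}$ and $\{\!\{~,~,~\}\!\}$ each defined as linear maps $A\otimes A\otimes M\to M$, $A\otimes M\otimes A\to M$, $M\otimes A\otimes A\to M$, such that the identities (AY1)-(AY11) hold whenever exactly one of the variables is in $M$ and the others are in $A$. A relative Rota-Baxter operator is a linear map $R:M\to A$ such that for all $u,v,w\in M$: $R(u)\cdot R(v)=R(R(u)\cdot v+u\cdot R(v))$; $\{R(u),R(v),R(w)\}=R(\{R(u),R(v),w\}+\{R(u),v,R(w)\}+\{u,R(v),R(w)\})$; $\{\!\{R(u),R(v),R(w)\}\!\}=R(\{\!\{R(u),R(v),w\}\!\}+\{\!\{R(u),v,R(w)\}\!\}+\{\!\{u,R(v),R(w)\}\!\})$. The dendriform-Yamaguti structure induced by $R$ on $M$ is $u\prec v:=u\cdot R(v)$, $u\succ v:=R(u)\cdot v$, $\{u,v,w\}_{[1]}:=\{u,R(v),R(w)\}$, $\{u,v,w\}_{[2]}:=\{R(u),v,R(w)\}$, $\{u,v,w\}_{[3]}:=\{R(u),R(v),w\}$, and the same formulas with $\{\!\{~,~,~\}\!\}$ in place of $\{~,~,~\}$. A dendriform-Yamaguti algebra is a vector space $D$ with linear operations $\prec,\succ:D\otimes D\to D$ and $\{~,~,~\}_{[i]},\{\!\{~,~,~\}\!\}_{[i]}:D\otimes D\otimes D\to D$ ($i=1,2,3$) such that, writing $a*b:=a\prec b+a\succ b$, $\{a,b,c\}_{\mathrm{Tot}}:=\sum_{i=1}^3\{a,b,c\}_{[i]}$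 and $\{\!\{a,b,c\}\!\}_{\mathrm{Tot}}:=\sum_{i=1}^3\{\!\{a,b,c\}\!\}_{[i]}$, the following hold for all $a,b,c,d,e\in D$: (DY1) $(a\prec b)\prec c-a\prec(b*c)+\{a,b,c\}_{[1]}-\{\!\{a,b,c\}\!\}_{[1]}=0$; $(a\succ b)\prec c-a\succ(b\prec c)+\{a,b,c\}_{[2]}-\{\!\{a,b,c\}\!\}_{[2]}=0$; $(a*b)\succ c-a\succ(b\succ c)+\{a,b,c\}_{[3]}-\{\!\{a,b,c\}\!\}_{[3]}=0$. (DY2) $\{a\prec b,c,d\}_{[1]}=\{a,b*c,d\}_{[1]}$; $\{a\succ b,c,d\}_{[1]}=\{a,b\prec c,d\}_{[2]}$; $\{a*b,c,d\}_{[2]}=\{a,b\succ c,d\}_{[2]}$; $\{a*b,c,d\}_{[3]}=\{a,b*c,d\}_{[3]}$. (DY3) $\{a,b,c*d\}_{[1]}=\{a,b,c\}_{[1]}\prec d$; $\{a,b,c*d\}_{[2]}=\{a,b,c\}_{[2]}\prec d$; $\{a,b,c\prec d\}_{[3]}=\{a,b,c\}_{[3]}\prec d$; $\{a,b,c\succ d\}_{[3]}=\{a,b,c\}_{\mathrm{Tot}}\succ d$. (DY4) $\{\!\{a\prec b,c,d\}\!\}_{[1]}=a\prec\{\!\{b,c,d\}\!\}_{\mathrm{Tot}}$; $\{\!\{a\succ b,c,d\}\!\}_{[1]}=a\succ\{\!\{b,c,d\}\!\}_{[1]}$; $\{\!\{a*b,c,d\}\!\}_{[2]}=a\succ\{\!\{b,c,d\}\!\}_{[2]}$;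 $\{\!\{a*b,c,d\}\!\}_{[3]}=a\succ\{\!\{b,c,d\}\!\}_{[3]}$. (DY5) $\{\!\{a,b*c,d\}\!\}_{[1]}=\{\!\{a,b,c*d\}\!\}_{[1]}$; $\{\!\{a,b\prec c,d\}\!\}_{[2]}=\{\!\{a,b,c*d\}\!\}_{[2]}$; $\{\!\{a,b\succ c,d\}\!\}_{[2]}=\{\!\{a,b,c\prec d\}\!\}_{[3]}$; $\{\!\{a,b*c,d\}\!\}_{[3]}=\{\!\{a,b,c\succ d\}\!\}_{[3]}$. (DY6) $a\prec\{b,c,d\}_{\mathrm{Tot}}=\{\!\{a,b,c\}\!\}_{[1]}\prec d$; $a\succ\{b,c,d\}_{[1]}=\{\!\{a,b,c\}\!\}_{[2]}\prec d$; $a\succ\{b,c,d\}_{[2]}=\{\!\{a,b,c\}\!\}_{[3]}\prec d$; $a\succ\{b,c,d\}_{[3]}=\{\!\{a,b,c\}\!\}_{\mathrm{Tot}}\succ d$. (DY7) $\{\{a,b,c\}_{[1]},d,e\}_{[1]}=\{a,\{\!\{b,c,d\}\!\}_{\mathrm{Tot}},e\}_{[1]}=\{a,b,\{c,d,e\}_{\mathrm{Tot}}\}_{[1]}$; $\{\{a,b,c\}_{[2]},d,e\}_{[1]}=\{a,\{\!\{b,c,d\}\!\}_{[1]},e\}_{[2]}=\{a,b,\{c,d,e\}_{\mathrm{Tot}}\}_{[2]}$; $\{\{a,b,c\}_{[3]},d,e\}_{[1]}=\{a,\{\!\{b,c,d\}\!\}_{[2]},e\}_{[2]}=\{a,b,\{c,d,e\}_{[1]}\}_{[3]}$;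 $\{\{a,b,c\}_{\mathrm{Tot}},d,e\}_{[2]}=\{a,\{\!\{b,c,d\}\!\}_{[3]},e\}_{[2]}=\{a,b,\{c,d,e\}_{[2]}\}_{[3]}$; $\{\{a,b,c\}_{\mathrm{Tot}},d,e\}_{[3]}=\{a,\{\!\{b,c,d\}\!\}_{\mathrm{Tot}},e\}_{[3]}=\{a,b,\{c,d,e\}_{[3]}\}_{[3]}$. (DY8) $\{a,\{b,c,d\}_{\mathrm{Tot}},e\}_{[1]}=\{\{\!\{a,b,c\}\!\}_{[1]},d,e\}_{[1]}$; $\{a,\{b,c,d\}_{[1]},e\}_{[2]}=\{\{\!\{a,b,c\}\!\}_{[2]},d,e\}_{[1]}$; $\{a,\{b,c,d\}_{[2]},e\}_{[2]}=\{\{\!\{a,b,c\}\!\}_{[3]},d,e\}_{[1]}$; $\{a,\{b,c,d\}_{[3]},e\}_{[2]}=\{\{\!\{a,b,c\}\!\}_{\mathrm{Tot}},d,e\}_{[2]}$; $\{a,\{b,c,d\}_{\mathrm{Tot}},e\}_{[3]}=\{\{\!\{a,b,c\}\!\}_{\mathrm{Tot}},d,e\}_{[3]}$. (DY9) $\{\!\{\{\!\{a,b,c\}\!\}_{[1]},d,e\}\!\}_{[1]}=\{\!\{a,\{b,c,d\}_{\mathrm{Tot}},e\}\!\}_{[1]}=\{\!\{a,b,\{\!\{c,d,e\}\!\}_{\mathrm{Tot}}\}\!\}_{[1]}$; $\{\!\{\{\!\{a,b,c\}\!\}_{[2]},d,e\}\!\}_{[1]}=\{\!\{a,\{b,c,d\}_{[1]},e\}\!\}_{[2]}=\{\!\{a,b,\{\!\{c,d,e\}\!\}_{\mathrm{Tot}}\}\!\}_{[2]}$;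 $\{\!\{\{\!\{a,b,c\}\!\}_{[3]},d,e\}\!\}_{[1]}=\{\!\{a,\{b,c,d\}_{[2]},e\}\!\}_{[2]}=\{\!\{a,b,\{\!\{c,d,e\}\!\}_{[1]}\}\!\}_{[3]}$; $\{\!\{\{\!\{a,b,c\}\!\}_{\mathrm{Tot}},d,e\}\!\}_{[2]}=\{\!\{a,\{b,c,d\}_{[3]},e\}\!\}_{[2]}=\{\!\{a,b,\{\!\{c,d,e\}\!\}_{[2]}\}\!\}_{[3]}$; $\{\!\{\{\!\{a,b,c\}\!\}_{\mathrm{Tot}},d,e\}\!\}_{[3]}=\{\!\{a,\{b,c,d\}_{\mathrm{Tot}},e\}\!\}_{[3]}=\{\!\{a,b,\{\!\{c,d,e\}\!\}_{[3]}\}\!\}_{[3]}$. (DY10) $\{\!\{a,\{\!\{b,c,d\}\!\}_{\mathrm{Tot}},e\}\!\}_{[1]}=\{\!\{a,b,\{c,d,e\}_{\mathrm{Tot}}\}\!\}_{[1]}$; $\{\!\{a,\{\!\{b,c,d\}\!\}_{[1]},e\}\!\}_{[2]}=\{\!\{a,b,\{c,d,e\}_{\mathrm{Tot}}\}\!\}_{[2]}$; $\{\!\{a,\{\!\{b,c,d\}\!\}_{[2]},e\}\!\}_{[2]}=\{\!\{a,b,\{c,d,e\}_{[1]}\}\!\}_{[3]}$; $\{\!\{a,\{\!\{b,c,d\}\!\}_{[3]},e\}\!\}_{[2]}=\{\!\{a,b,\{c,d,e\}_{[2]}\}\!\}_{[3]}$; $\{\!\{a,\{\!\{b,c,d\}\!\}_{\mathrm{Tot}},e\}\!\}_{[3]}=\{\!\{a,b,\{c,d,e\}_{[3]}\}\!\}_{[3]}$.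 (DY11) $\{a,b,\{\!\{c,d,e\}\!\}_{\mathrm{Tot}}\}_{[1]}=\{\!\{\{a,b,c\}_{[1]},d,e\}\!\}_{[1]}$; $\{a,b,\{\!\{c,d,e\}\!\}_{\mathrm{Tot}}\}_{[2]}=\{\!\{\{a,b,c\}_{[2]},d,e\}\!\}_{[1]}$; $\{a,b,\{\!\{c,d,e\}\!\}_{[1]}\}_{[3]}=\{\!\{\{a,b,c\}_{[3]},d,e\}\!\}_{[1]}$; $\{a,b,\{\!\{c,d,e\}\!\}_{[2]}\}_{[3]}=\{\!\{\{a,b,c\}_{\mathrm{Tot}},d,e\}\!\}_{[2]}$; $\{a,b,\{\!\{c,d,e\}\!\}_{[3]}\}_{[3]}=\{\!\{\{a,b,c\}_{\mathrm{Tot}},d,e\}\!\}_{[3]}$. For a dendriform-Yamaguti algebra $D$, the total associative-Yamaguti algebra $D_{\mathrm{Tot}}$ is the vector space $D$ with $a\cdot_{\mathrm{Tot}}b=a\prec b+a\succ b$ and the operations $\{~,~,~\}_{\mathrm{Tot}}$, $\{\!\{~,~,~\}\!\}_{\mathrm{Tot}}$ above (it is an associative-Yamaguti algebra). *)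

(* Defs.v *)
From mathcomp Require Import all_boot all_algebra.

Set Implicit Arguments.
Unset Strict Implicit.
Unset Printing Implicit Defensive.

Import GRing.Theory.
Local Open Scope ring_scope.

(* Linear maps out of U (x) V and U (x) V (x) W are given in curried form. *)
Definition bilinear_map (K : fieldType) (U V W : lmodType K)
    (f : U -> V -> W) : Prop :=
  (forall y, linear (f^~ y)) /\ (forall x, linear (f x)).

Definition trilinear_map (K : fieldType) (U V W X : lmodType K)
    (f : U -> V -> W -> X) : Prop :=
  [/\ forall y z, linear (fun x => f x y z),
      forall x z, linear (fun y => f x y z)
    & forall x y, linear (f x y)].

(* ay_br is {_,_,_} and ay_dbr is the double bracket {{_,_,_}}. *)
Record ay_ops (V : Type) : Type := AYOps {
  ay_mul : V -> V -> V;
  ay_br : V -> V -> V -> V;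
  ay_dbr : V -> V -> V -> V
}.

Section AssocYamaguti.
Context (K : fieldType) (V : lmodType K) (o : ay_ops V).
Local Notation "a ** b" := (ay_mul o a b) (at level 40, left associativity).
Local Notation br := (ay_br o).
Local Notation dbr := (ay_dbr o).

Record ay_axioms : Prop := AYAxioms {
  ay_mul_linear : bilinear_map (ay_mul o);
  ay_br_linear : trilinear_map br;
  ay_dbr_linear : trilinear_map dbr;
  AY1 : forall a b c,
        (a ** b) ** c - a ** (b ** c) + br a b c - dbr a b c = 0;
  AY2 : forall a b c d,
        br (a ** b) c d = br a (b ** c) d;
  AY3 : forall a b c d,
        br a b (c ** d) = (br a b c) ** d;
  AY4 : forall a b c d,
        dbr (a ** b) c d = a ** (dbr b c d);
  AY5 : forall a b c d,
        dbr a (b ** c) d = dbr a b (c ** d);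
  AY6 : forall a b c d,
        a ** (br b c d) = (dbr a b c) ** d;
  AY7 : forall a b c d e,
        br (br a b c) d e = br a (dbr b c d) e /\
        br a (dbr b c d) e = br a b (br c d e);
  AY8 : forall a b c d e,
        br a (br b c d) e = br (dbr a b c) d e;
  AY9 : forall a b c d e,
        dbr (dbr a b c) d e = dbr a (br b c d) e /\
        dbr a (br b c d) e = dbr a b (dbr c d e);
  AY10 : forall a b c d e,
        dbr a (dbr b c d) e = dbr a b (br c d e);
  AY11 : forall a b c d e,
        br a b (dbr c d e) = dbr (br a b c) d e
}.

End AssocYamaguti.

Record assocYam (K : fieldType) : Type := AssocYam {
  ay_space :> lmodType K;
  ay_str : ay_ops ay_space;
  ay_ax : ay_axioms ay_str
}.

Record action_ops (A M : Type) : Type := ActionOps {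
  lact : A -> M -> M;
  ract : M -> A -> M;
  brAAM : A -> A -> M -> M;
  brAMA : A -> M -> A -> M;
  brMAA : M -> A -> A -> M;
  dbrAAM : A -> A -> M -> M;
  dbrAMA : A -> M -> A -> M;
  dbrMAA : M -> A -> A -> M
}.

Section Representation.
Context (K : fieldType) (A : assocYam K) (M : lmodType K) (r : action_ops A M).
Local Notation "a ** b" := (ay_mul (ay_str A) a b)
  (at level 40, left associativity).
Local Notation br := (ay_br (ay_str A)).
Local Notation dbr := (ay_dbr (ay_str A)).
Local Notation "a *> x" := (lact r a x) (at level 40, left associativity).
Local Notation "x <* a" := (ract r x a) (at level 40, left associativity).
Local Notation brAAM := (brAAM r).
Local Notation brAMA := (brAMA r).
Local Notation brMAA := (brMAA r).
Local Notation dbrAAM := (dbrAAM r).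
Local Notation dbrAMA := (dbrAMA r).
Local Notation dbrMAA := (dbrMAA r).

(* In each conjunct, x is the variable that lies in M. *)
Record is_representation : Prop := IsRepresentation {
  lact_linear : bilinear_map (lact r);
  ract_linear : bilinear_map (ract r);
  brAAM_linear : trilinear_map brAAM;
  brAMA_linear : trilinear_map brAMA;
  brMAA_linear : trilinear_map brMAA;
  dbrAAM_linear : trilinear_map dbrAAM;
  dbrAMA_linear : trilinear_map dbrAMA;
  dbrMAA_linear : trilinear_map dbrMAA;
  rep_AY1 : [/\ forall x b c,
        (x <* b) <* c - x <* (b ** c) + brMAA x b c - dbrMAA x b c = 0,
      forall a x c,
        (a *> x) <* c - a *> (x <* c) + brAMA a x c - dbrAMA a x c = 0
    & forall a b x,
        (a ** b) *> x - a *> (b *> x) + brAAM a b x - dbrAAM a b x = 0];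
  rep_AY2 : [/\ forall x b c d,
        brMAA (x <* b) c d = brMAA x (b ** c) d,
      forall a x c d,
        brMAA (a *> x) c d = brAMA a (x <* c) d,
      forall a b x d,
        brAMA (a ** b) x d = brAMA a (b *> x) d
    & forall a b c x,
        brAAM (a ** b) c x = brAAM a (b ** c) x];
  rep_AY3 : [/\ forall x b c d,
        brMAA x b (c ** d) = (brMAA x b c) <* d,
      forall a x c d,
        brAMA a x (c ** d) = (brAMA a x c) <* d,
      forall a b x d,
        brAAM a b (x <* d) = (brAAM a b x) <* d
    & forall a b c x,
        brAAM a b (c *> x) = (br a b c) *> x];
  rep_AY4 : [/\ forall x b c d,
        dbrMAA (x <* b) c d = x <* (dbr b c d),
      forall a x c d,
        dbrMAA (a *> x) c d = a *> (dbrMAA x c d),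
      forall a b x d,
        dbrAMA (a ** b) x d = a *> (dbrAMA b x d)
    & forall a b c x,
        dbrAAM (a ** b) c x = a *> (dbrAAM b c x)];
  rep_AY5 : [/\ forall x b c d,
        dbrMAA x (b ** c) d = dbrMAA x b (c ** d),
      forall a x c d,
        dbrAMA a (x <* c) d = dbrAMA a x (c ** d),
      forall a b x d,
        dbrAMA a (b *> x) d = dbrAAM a b (x <* d)
    & forall a b c x,
        dbrAAM a (b ** c) x = dbrAAM a b (c *> x)];
  rep_AY6 : [/\ forall x b c d,
        x <* (br b c d) = (dbrMAA x b c) <* d,
      forall a x c d,
        a *> (brMAA x c d) = (dbrAMA a x c) <* d,
      forall a b x d,
        a *> (brAMA b x d) = (dbrAAM a b x) <* d
    & forall a b c x,
        a *> (brAAM b c x) = (dbr a b c) *> x];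
  rep_AY7 : [/\ forall x b c d e,
        brMAA (brMAA x b c) d e = brMAA x (dbr b c d) e /\
        brMAA x (dbr b c d) e = brMAA x b (br c d e),
      forall a x c d e,
        brMAA (brAMA a x c) d e = brAMA a (dbrMAA x c d) e /\
        brAMA a (dbrMAA x c d) e = brAMA a x (br c d e),
      forall a b x d e,
        brMAA (brAAM a b x) d e = brAMA a (dbrAMA b x d) e /\
        brAMA a (dbrAMA b x d) e = brAAM a b (brMAA x d e),
      forall a b c x e,
        brAMA (br a b c) x e = brAMA a (dbrAAM b c x) e /\
        brAMA a (dbrAAM b c x) e = brAAM a b (brAMA c x e)
    & forall a b c d x,
        brAAM (br a b c) d x = brAAM a (dbr b c d) x /\
        brAAM a (dbr b c d) x = brAAM a b (brAAM c d x)];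
  rep_AY8 : [/\ forall x b c d e,
        brMAA x (br b c d) e = brMAA (dbrMAA x b c) d e,
      forall a x c d e,
        brAMA a (brMAA x c d) e = brMAA (dbrAMA a x c) d e,
      forall a b x d e,
        brAMA a (brAMA b x d) e = brMAA (dbrAAM a b x) d e,
      forall a b c x e,
        brAMA a (brAAM b c x) e = brAMA (dbr a b c) x e
    & forall a b c d x,
        brAAM a (br b c d) x = brAAM (dbr a b c) d x];
  rep_AY9 : [/\ forall x b c d e,
        dbrMAA (dbrMAA x b c) d e = dbrMAA x (br b c d) e /\
        dbrMAA x (br b c d) e = dbrMAA x b (dbr c d e),
      forall a x c d e,
        dbrMAA (dbrAMA a x c) d e = dbrAMA a (brMAA x c d) e /\
        dbrAMA a (brMAA x c d) e = dbrAMA a x (dbr c d e),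
      forall a b x d e,
        dbrMAA (dbrAAM a b x) d e = dbrAMA a (brAMA b x d) e /\
        dbrAMA a (brAMA b x d) e = dbrAAM a b (dbrMAA x d e),
      forall a b c x e,
        dbrAMA (dbr a b c) x e = dbrAMA a (brAAM b c x) e /\
        dbrAMA a (brAAM b c x) e = dbrAAM a b (dbrAMA c x e)
    & forall a b c d x,
        dbrAAM (dbr a b c) d x = dbrAAM a (br b c d) x /\
        dbrAAM a (br b c d) x = dbrAAM a b (dbrAAM c d x)];
  rep_AY10 : [/\ forall x b c d e,
        dbrMAA x (dbr b c d) e = dbrMAA x b (br c d e),
      forall a x c d e,
        dbrAMA a (dbrMAA x c d) e = dbrAMA a x (br c d e),
      forall a b x d e,
        dbrAMA a (dbrAMA b x d) e = dbrAAM a b (brMAA x d e),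
      forall a b c x e,
        dbrAMA a (dbrAAM b c x) e = dbrAAM a b (brAMA c x e)
    & forall a b c d x,
        dbrAAM a (dbr b c d) x = dbrAAM a b (brAAM c d x)];
  rep_AY11 : [/\ forall x b c d e,
        brMAA x b (dbr c d e) = dbrMAA (brMAA x b c) d e,
      forall a x c d e,
        brAMA a x (dbr c d e) = dbrMAA (brAMA a x c) d e,
      forall a b x d e,
        brAAM a b (dbrMAA x d e) = dbrMAA (brAAM a b x) d e,
      forall a b c x e,
        brAAM a b (dbrAMA c x e) = dbrAMA (br a b c) x e
    & forall a b c d x,
        brAAM a b (dbrAAM c d x) = dbrAAM (br a b c) d x]
}.

Record is_relative_RB (R : M -> A) : Prop := IsRelativeRB {
  RB_linear : linear R;
  RB_mul : forall u v, R u ** R v = R (R u *> v + u <* R v);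
  RB_br : forall u v w, br (R u) (R v) (R w)
    = R (brAAM (R u) (R v) w + brAMA (R u) v (R w) + brMAA u (R v) (R w));
  RB_dbr : forall u v w, dbr (R u) (R v) (R w)
    = R (dbrAAM (R u) (R v) w + dbrAMA (R u) v (R w) + dbrMAA u (R v) (R w))
}.

End Representation.

Record dy_ops (V : Type) : Type := DYOps {
  dy_prec : V -> V -> V;
  dy_succ : V -> V -> V;
  dy_br1 : V -> V -> V -> V;
  dy_br2 : V -> V -> V -> V;
  dy_br3 : V -> V -> V -> V;
  dy_dbr1 : V -> V -> V -> V;
  dy_dbr2 : V -> V -> V -> V;
  dy_dbr3 : V -> V -> V -> V
}.

Definition dy_total_ops (V : zmodType) (o : dy_ops V) : ay_ops V := {|
  ay_mul a b := dy_prec o a b + dy_succ o a b;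
  ay_br a b c := dy_br1 o a b c + dy_br2 o a b c + dy_br3 o a b c;
  ay_dbr a b c := dy_dbr1 o a b c + dy_dbr2 o a b c + dy_dbr3 o a b c
|}.

Section DendriformYamaguti.
Context (K : fieldType) (V : lmodType K) (o : dy_ops V).
Local Notation "a <~ b" := (dy_prec o a b) (at level 40, left associativity).
Local Notation "a ~> b" := (dy_succ o a b) (at level 40, left associativity).
Local Notation "a ** b" := (ay_mul (dy_total_ops o) a b)
  (at level 40, left associativity).
Local Notation br1 := (dy_br1 o).
Local Notation br2 := (dy_br2 o).
Local Notation br3 := (dy_br3 o).
Local Notation brT := (ay_br (dy_total_ops o)).
Local Notation dbr1 := (dy_dbr1 o).
Local Notation dbr2 := (dy_dbr2 o).
Local Notation dbr3 := (dy_dbr3 o).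
Local Notation dbrT := (ay_dbr (dy_total_ops o)).

Record dy_axioms : Prop := DYAxioms {
  dy_prec_linear : bilinear_map (dy_prec o);
  dy_succ_linear : bilinear_map (dy_succ o);
  dy_br1_linear : trilinear_map br1;
  dy_br2_linear : trilinear_map br2;
  dy_br3_linear : trilinear_map br3;
  dy_dbr1_linear : trilinear_map dbr1;
  dy_dbr2_linear : trilinear_map dbr2;
  dy_dbr3_linear : trilinear_map dbr3;
  DY1 : [/\ forall a b c,
        (a <~ b) <~ c - a <~ (b ** c) + br1 a b c - dbr1 a b c = 0,
      forall a b c,
        (a ~> b) <~ c - a ~> (b <~ c) + br2 a b c - dbr2 a b c = 0
    & forall a b c,
        (a ** b) ~> c - a ~> (b ~> c) + br3 a b c - dbr3 a b c = 0];
  DY2 : [/\ forall a b c d,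
        br1 (a <~ b) c d = br1 a (b ** c) d,
      forall a b c d,
        br1 (a ~> b) c d = br2 a (b <~ c) d,
      forall a b c d,
        br2 (a ** b) c d = br2 a (b ~> c) d
    & forall a b c d,
        br3 (a ** b) c d = br3 a (b ** c) d];
  DY3 : [/\ forall a b c d,
        br1 a b (c ** d) = (br1 a b c) <~ d,
      forall a b c d,
        br2 a b (c ** d) = (br2 a b c) <~ d,
      forall a b c d,
        br3 a b (c <~ d) = (br3 a b c) <~ d
    & forall a b c d,
        br3 a b (c ~> d) = (brT a b c) ~> d];
  DY4 : [/\ forall a b c d,
        dbr1 (a <~ b) c d = a <~ (dbrT b c d),
      forall a b c d,
        dbr1 (a ~> b) c d = a ~> (dbr1 b c d),
      forall a b c d,
        dbr2 (a ** b) c d = a ~> (dbr2 b c d)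
    & forall a b c d,
        dbr3 (a ** b) c d = a ~> (dbr3 b c d)];
  DY5 : [/\ forall a b c d,
        dbr1 a (b ** c) d = dbr1 a b (c ** d),
      forall a b c d,
        dbr2 a (b <~ c) d = dbr2 a b (c ** d),
      forall a b c d,
        dbr2 a (b ~> c) d = dbr3 a b (c <~ d)
    & forall a b c d,
        dbr3 a (b ** c) d = dbr3 a b (c ~> d)];
  DY6 : [/\ forall a b c d,
        a <~ (brT b c d) = (dbr1 a b c) <~ d,
      forall a b c d,
        a ~> (br1 b c d) = (dbr2 a b c) <~ d,
      forall a b c d,
        a ~> (br2 b c d) = (dbr3 a b c) <~ d
    & forall a b c d,
        a ~> (br3 b c d) = (dbrT a b c) ~> d];
  DY7 : [/\ forall a b c d e,
        br1 (br1 a b c) d e = br1 a (dbrT b c d) e /\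
        br1 a (dbrT b c d) e = br1 a b (brT c d e),
      forall a b c d e,
        br1 (br2 a b c) d e = br2 a (dbr1 b c d) e /\
        br2 a (dbr1 b c d) e = br2 a b (brT c d e),
      forall a b c d e,
        br1 (br3 a b c) d e = br2 a (dbr2 b c d) e /\
        br2 a (dbr2 b c d) e = br3 a b (br1 c d e),
      forall a b c d e,
        br2 (brT a b c) d e = br2 a (dbr3 b c d) e /\
        br2 a (dbr3 b c d) e = br3 a b (br2 c d e)
    & forall a b c d e,
        br3 (brT a b c) d e = br3 a (dbrT b c d) e /\
        br3 a (dbrT b c d) e = br3 a b (br3 c d e)];
  DY8 : [/\ forall a b c d e,
        br1 a (brT b c d) e = br1 (dbr1 a b c) d e,
      forall a b c d e,
        br2 a (br1 b c d) e = br1 (dbr2 a b c) d e,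
      forall a b c d e,
        br2 a (br2 b c d) e = br1 (dbr3 a b c) d e,
      forall a b c d e,
        br2 a (br3 b c d) e = br2 (dbrT a b c) d e
    & forall a b c d e,
        br3 a (brT b c d) e = br3 (dbrT a b c) d e];
  DY9 : [/\ forall a b c d e,
        dbr1 (dbr1 a b c) d e = dbr1 a (brT b c d) e /\
        dbr1 a (brT b c d) e = dbr1 a b (dbrT c d e),
      forall a b c d e,
        dbr1 (dbr2 a b c) d e = dbr2 a (br1 b c d) e /\
        dbr2 a (br1 b c d) e = dbr2 a b (dbrT c d e),
      forall a b c d e,
        dbr1 (dbr3 a b c) d e = dbr2 a (br2 b c d) e /\
        dbr2 a (br2 b c d) e = dbr3 a b (dbr1 c d e),
      forall a b c d e,
        dbr2 (dbrT a b c) d e = dbr2 a (br3 b c d) e /\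
        dbr2 a (br3 b c d) e = dbr3 a b (dbr2 c d e)
    & forall a b c d e,
        dbr3 (dbrT a b c) d e = dbr3 a (brT b c d) e /\
        dbr3 a (brT b c d) e = dbr3 a b (dbr3 c d e)];
  DY10 : [/\ forall a b c d e,
        dbr1 a (dbrT b c d) e = dbr1 a b (brT c d e),
      forall a b c d e,
        dbr2 a (dbr1 b c d) e = dbr2 a b (brT c d e),
      forall a b c d e,
        dbr2 a (dbr2 b c d) e = dbr3 a b (br1 c d e),
      forall a b c d e,
        dbr2 a (dbr3 b c d) e = dbr3 a b (br2 c d e)
    & forall a b c d e,
        dbr3 a (dbrT b c d) e = dbr3 a b (br3 c d e)];
  DY11 : [/\ forall a b c d e,
        br1 a b (dbrT c d e) = dbr1 (br1 a b c) d e,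
      forall a b c d e,
        br2 a b (dbrT c d e) = dbr1 (br2 a b c) d e,
      forall a b c d e,
        br3 a b (dbr1 c d e) = dbr1 (br3 a b c) d e,
      forall a b c d e,
        br3 a b (dbr2 c d e) = dbr2 (brT a b c) d e
    & forall a b c d e,
        br3 a b (dbr3 c d e) = dbr3 (brT a b c) d e]
}.

End DendriformYamaguti.

Record dendYam (K : fieldType) : Type := DendYam {
  dy_space :> lmodType K;
  dy_str : dy_ops dy_space;
  dy_ax : dy_axioms dy_str
}.

Definition RB_induced_ops (K : fieldType) (A : assocYam K) (M : lmodType K)
    (r : action_ops A M) (R : M -> A) : dy_ops M := {|
  dy_prec u v := ract r u (R v);
  dy_succ u v := lact r (R u) v;
  dy_br1 u v w := brMAA r u (R v) (R w);
  dy_br2 u v w := brAMA r (R u) v (R w);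
  dy_br3 u v w := brAAM r (R u) (R v) w;
  dy_dbr1 u v w := dbrMAA r u (R v) (R w);
  dy_dbr2 u v w := dbrAMA r (R u) v (R w);
  dy_dbr3 u v w := dbrAAM r (R u) (R v) w
|}.

Section Total.
Context (K : fieldType).

Lemma bilinear_mapD (U V W : lmodType K) (f : U -> V -> W) :
  bilinear_map f ->
  (forall x x' y, f (x + x') y = f x y + f x' y) *
  (forall x y y', f x (y + y') = f x y + f x y').
Proof.
case=> l r; split=> [x x' y|x y y'].
  by have := l y 1 x x'; rewrite /= !scale1r.
by have := r x 1 y y'; rewrite /= !scale1r.
Qed.

Lemma trilinear_mapD (U V W X : lmodType K) (f : U -> V -> W -> X) :
  trilinear_map f ->
  (forall x x' y z, f (x + x') y z = f x y z + f x' y z) *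
  (forall x y y' z, f x (y + y') z = f x y z + f x y' z) *
  (forall x y z z', f x y (z + z') = f x y z + f x y z').
Proof.
case=> l m r; split; first split.
- by move=> x x' y z; have := l y z 1 x x'; rewrite /= !scale1r.
- by move=> x y y' z; have := m x z 1 y y'; rewrite /= !scale1r.
- by move=> x y z z'; have := r x y 1 z z'; rewrite /= !scale1r.
Qed.

Lemma linear_addf (U V : lmodType K) (f g : U -> V) :
  linear f -> linear g -> linear (fun x => f x + g x).
Proof. by move=> lf lg a x y; rewrite lf lg scalerDr addrACA. Qed.

Lemma bilinear_map_add (U V W : lmodType K) (f g : U -> V -> W) :
  bilinear_map f -> bilinear_map g -> bilinear_map (fun x y => f x y + g x y).
Proof.
by case=> f1 f2 [g1 g2]; split=> x; [exact: (linear_addf (f1 x) (g1 x))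
  | exact: (linear_addf (f2 x) (g2 x))].
Qed.

Lemma trilinear_map_add (U V W X : lmodType K) (f g : U -> V -> W -> X) :
  trilinear_map f -> trilinear_map g ->
  trilinear_map (fun x y z => f x y z + g x y z).
Proof.
case=> f1 f2 f3 [g1 g2 g3]; split=> x y.
- exact: (linear_addf (f1 x y) (g1 x y)).
- exact: (linear_addf (f2 x y) (g2 x y)).
- exact: (linear_addf (f3 x y) (g3 x y)).
Qed.

Lemma dy_total_axioms (V : lmodType K) (o : dy_ops V) :
  dy_axioms o -> ay_axioms (dy_total_ops o).
Proof.
case=> lp ls lb1 lb2 lb3 ld1 ld2 ld3.
have [pl pr] := bilinear_mapD lp; have [sl sr] := bilinear_mapD ls.
have [[b1l b1m] b1r] := trilinear_mapD lb1.
have [[b2l b2m] b2r] := trilinear_mapD lb2.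
have [[b3l b3m] b3r] := trilinear_mapD lb3.
have [[d1l d1m] d1r] := trilinear_mapD ld1.
have [[d2l d2m] d2r] := trilinear_mapD ld2.
have [[d3l d3m] d3r] := trilinear_mapD ld3.
move=> A1 A2 A3 A4 A5 A6 A7 A8 A9 A10 A11.
have add2 (x1 x2 x3 y1 y2 y3 : V) :
    x1 + x2 + x3 + (y1 + y2 + y3) = (x1 + y1) + (x2 + y2) + (x3 + y3).
  by rewrite addrACA (addrACA x1).
have add4 (x1 x2 x3 y1 y2 y3 z1 z2 z3 t1 t2 t3 : V) :
    x1 + x2 + x3 - (y1 + y2 + y3) + (z1 + z2 + z3) - (t1 + t2 + t3) =
    (x1 - y1 + z1 - t1) + (x2 - y2 + z2 - t2) + (x3 - y3 + z3 - t3).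
  have sub2 u1 u2 u3 v1 v2 v3 : u1 + u2 + u3 - (v1 + v2 + v3) =
      (u1 - v1) + (u2 - v2) + (u3 - v3) :> V by rewrite !opprD add2.
  by rewrite [X in X + _ - _]sub2 [X in X - _]add2 sub2.
split=> /=.
- exact: bilinear_map_add lp ls.
- exact: trilinear_map_add (trilinear_map_add lb1 lb2) lb3.
- exact: trilinear_map_add (trilinear_map_add ld1 ld2) ld3.
- move=> a b c; case: A1 => h1 h2 h3; move: (h1 a b c) (h2 a b c) (h3 a b c).
  rewrite /= => e1 e2 e3; rewrite pl (sr a) [dy_prec o a _ + (_ + _)]addrA.
  by rewrite add4 e1 e2 e3 !addr0.
- case: A2 => /= h1 h2 h3 h4 a b c d.
  by rewrite b1l b2m h1 h2 h3 h4 !addrA.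
- case: A3 => /= h1 h2 h3 h4 a b c d.
  by rewrite b3r !pl h1 h2 h3 h4 !addrA.
- case: A4 => /= h1 h2 h3 h4 a b c d.
  by rewrite d1l !sr h1 h2 h3 h4 !addrA.
- case: A5 => /= h1 h2 h3 h4 a b c d.
  by rewrite d2m d3r h1 h2 h3 h4 !addrA.
- case: A6 => /= h1 h2 h3 h4 a b c d.
  by rewrite !pl !sr h1 h2 h3 h4 !addrA.
- case: A7 => /= h1 h2 h3 h4 h5 a b c d e.
  have [[p1 q1] [p2 q2] [p3 q3]] :=
    And3 (h1 a b c d e) (h2 a b c d e) (h3 a b c d e).
  have [[p4 q4] [p5 q5]] := conj (h4 a b c d e) (h5 a b c d e).
  by split; rewrite ?b1l ?b1l !b2m ?b3r ?b3r ?(p1, p2, p3, p4, p5)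
    ?(q1, q2, q3, q4, q5) !addrA.
- case: A8 => /= h1 h2 h3 h4 h5 a b c d e.
  by rewrite !b2m !b1l h1 h2 h3 h4 h5 !addrA.
- case: A9 => /= h1 h2 h3 h4 h5 a b c d e.
  have [[p1 q1] [p2 q2] [p3 q3]] :=
    And3 (h1 a b c d e) (h2 a b c d e) (h3 a b c d e).
  have [[p4 q4] [p5 q5]] := conj (h4 a b c d e) (h5 a b c d e).
  by split; rewrite ?d1l ?d1l !d2m ?d3r ?d3r ?(p1, p2, p3, p4, p5)
    ?(q1, q2, q3, q4, q5) !addrA.
- case: A10 => /= h1 h2 h3 h4 h5 a b c d e.
  by rewrite !d2m !d3r h1 h2 h3 h4 h5 !addrA.
- case: A11 => /= h1 h2 h3 h4 h5 a b c d e.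
  by rewrite !b3r !d1l h1 h2 h3 h4 h5 !addrA.
Qed.

Definition dy_total (D : dendYam K) : assocYam K :=
  AssocYam (dy_total_axioms (dy_ax D)).

End Total.

Definition dy_actions (K : fieldType) (D : dendYam K) :
    action_ops (dy_total D) D := {|
  lact := dy_succ (dy_str D);
  ract := dy_prec (dy_str D);
  brAAM := dy_br3 (dy_str D);
  brAMA := dy_br2 (dy_str D);
  brMAA := dy_br1 (dy_str D);
  dbrAAM := dy_dbr3 (dy_str D);
  dbrAMA := dy_dbr2 (dy_str D);
  dbrMAA := dy_dbr1 (dy_str D)
|}.

(* Main.v *)
Require Import Defs.
From mathcomp Require Import all_boot all_algebra.

(** Each dendriform axiom is an associative-Yamaguti axiom split by which variable lies in the
    module: [[i]] marks slot [i], and totals appear where all entries of an operation lie in the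
    algebra. *)

Theorem theorem6p15 (K : fieldType) (charK : [pchar K]%R =i pred0)
    (D : dendYam K) :
  is_representation (dy_actions D) /\
  (is_relative_RB (dy_actions D) (id : D -> dy_total D) /\
   RB_induced_ops (dy_actions D) (id : D -> dy_total D) = dy_str D).
Proof.
(* The total operations list the summands in the opposite order to the
   Rota-Baxter identities. *)
have rev3 (x y z : D) : (x + y + z = z + y + x)%R.
  by rewrite GRing.addrC (GRing.addrC x) GRing.addrA.
split; last split.
- by case: (dy_ax D); split.
(* [rev3] settles both ternary identities here; only the binary product remains. *)
- split=> //= u v.
  exact: GRing.addrC.
(* Destructing [dy_str D] supplies eta for the record. *)
- by rewrite /RB_induced_ops /=; case: (dy_str D).
Qed.
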